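(* Let $A$ be a primitive set such that every prime dividing some element of $A$ lies in the interval $[3,\exp(10^6)]$. Then $$\sum_{a\in A}\frac{1}{a\log a}\le\sum_{p\in\mathcal{P}(A)}\frac{1}{p\log p},$$ where $\mathcal P(A)$ is the set of primes dividing at least one element of $A$.
   Context: A set $A$ of integers greater than $1$ is primitive if no element of $A$ divides any other element of $A$. *)

(* Defs.v *)
From HB Require Import structures.
From mathcomp Require Import all_boot all_order all_algebra.
From mathcomp Require Import all_classical all_reals all_analysis.

Set Implicit Arguments.
Unset Strict Implicit.
Unset Printing Implicit Defensive.

Import Order.TTheory GRing.Theory Num.Theory.

Local Open Scope classical_set_scope.
Local Open Scope ring_scope.

Definition primitive (A : set nat) : Prop :=
  (forall a, A a -> (1 < a)%N) /\
  (forall a b, A a -> A b -> (a %| b)%N -> a = b).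

Definition prime_divisors_of (A : set nat) : set nat :=
  [set p | prime p /\ exists2 a, A a & (p %| a)%N].

(* [A] may be infinite: the sum is the supremum in [\bar R] of the finite
   subsums, which is the usual value when every element of [A] is > 1, since
   the terms are then positive. *)
Definition erdos_sum (R : realType) (A : set nat) : \bar R :=
  \esum_(a in A) (1 / (a%:R * ln a%:R))%:E.

(* Main.v *)
Require Import Defs.
From mathcomp Require Import all_boot all_order all_algebra.
From mathcomp Require Import all_classical all_reals all_analysis.
From mathcomp Require Import zify ring lra.

(* Since the von Mangoldt function L satisfies sum_(d | m) L(d) = ln m, moving
   from m to m / d with probability L(d) / ln m is a random walk down the
   divisibility order.  The weight w(n) = 1 / (n ln n) is superharmonic for this
   walk on odd numbers: the inflow into n is
     (1 / n) sum_(d odd) L(d) / (d (ln n + ln d)^2),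
   and the Mertens-type estimate, for x >= 2,
     sum_(d <= x, d odd) L(d) / d <= ln x - (ln 2) / 4
   bounds it by 1 / (n (ln n + (ln 2) / 4)) < w(n).  The jumps from a prime power to 1
   are diverted to the prime, for which the gain (ln 2) / 4 pays.  A walk meets a
   primitive set at most once, so starting it with mass w(a) at each a in A,
   every n receives at most w(n), and all the mass is finally absorbed by primes
   dividing elements of A. *)

Import Order.TTheory GRing.Theory Num.Theory.

Local Open Scope classical_set_scope.
Local Open Scope ring_scope.

(** * The von Mangoldt function and Legendre's formula *)

Definition mangoldt (R : realType) (n : nat) : R :=
  if primes n is [:: p] then ln p%:R else 0.

Lemma mangoldtX (R : realType) (p k : nat) :
  prime p -> (0 < k)%N -> mangoldt R (p ^ k) = ln p%:R.
Proof. by move=> pp k0; rewrite /mangoldt primesX// primes_prime. Qed.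

Lemma mangoldt_neq0 (R : realType) (n : nat) : mangoldt R n != 0 ->
  exists p, [/\ prime p, (0 < logn p n)%N & n = (p ^ logn p n)%N].
Proof.
rewrite /mangoldt; case E: (primes n) => [|p [|? ?]]; rewrite ?eqxx// => _.
have : p \in primes n by rewrite E inE.
rewrite mem_primes => /and3P[pp n0 pn]; exists p; split=> //.
  by rewrite logn_gt0 mem_primes pp n0.
rewrite -p_part part_pnat_id// /pnat n0 E/= andbT.
by rewrite inE/=.
Qed.

Lemma mangoldt_ge0 (R : realType) (n : nat) : 0 <= mangoldt R n.
Proof.
rewrite /mangoldt; case: (primes n) => [|p [|? ?]]//.
by case: p => [|p]; [rewrite ln0 | rewrite ln_ge0// ler1n].
Qed.

(** Strip the least prime factor [p], so that n = m p. Among the divisors of n that do not divide m,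
    the only prime power is the full power p ^ e, which contributes ln p. *)
Lemma sum_mangoldt_dvd (R : realType) (B n : nat) : (0 < n)%N -> (n < B)%N ->
  \sum_(0 <= d < B | (d %| n)%N) mangoldt R d = ln n%:R.
Proof.
elim/ltn_ind: n => n IH n0 nB.
have [n1|n1] := leqP n 1.
  have -> : n = 1%N by lia.
  rewrite ln1 big1// => d; rewrite dvdn1 => /eqP ->.
  by rewrite /mangoldt.
pose p := pdiv n; pose m := (n %/ p)%N; pose e := logn p n.
have pp : prime p by exact: pdiv_prime.
have nE : n = (m * p)%N by rewrite /m divnK// pdiv_dvd.
have m0 : (0 < m)%N by rewrite divn_gt0 ?prime_gt0// dvdn_leq// pdiv_dvd.
have mn : (m < n)%N by rewrite nE ltn_Pmulr// prime_gt1.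
have eE : e = (logn p m).+1.
  by rewrite /e nE lognM ?(prime_gt0 pp)// (logn_prime _ pp) eqxx addn1.
rewrite (bigID (fun d => d %| m)%N)/=.
rewrite (eq_bigl (fun d => d %| m)%N); last first.
  by move=> d; rewrite andb_idl// nE => /dvdn_mulr ->.
rewrite IH//; last exact: ltn_trans nB.
have peB : (p ^ e < B)%N.
  by apply: leq_ltn_trans nB; rewrite dvdn_leq// pfactor_dvdn.
rewrite (_ : \sum_(_ <= _ < _ | _) _ = ln p%:R); last first.
  transitivity (\sum_(0 <= d < B | (d == p ^ e)%N) mangoldt R d); last first.
    by rewrite big_nat1_eq/= peB mangoldtX// eE.
  rewrite big_mkcond [RHS]big_mkcond; apply: eq_bigr => d _.
  case: eqVneq => [->|dpe].
    by rewrite pfactor_dvdn// leqnn pfactor_dvdn//= -/e eE ltnn.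
  case: ifP => // /andP[dn dm].
  apply/eqP/negPn/negP => /mangoldt_neq0[q [qp k0 dE]].
  have [qpE|qNp] := eqVneq q p.
    move: dn dm dpe; rewrite dE qpE !pfactor_dvdn// -/e eE.
    move=> le1; rewrite -ltnNge => le2; case/negP; apply/eqP.
    by congr (p ^ _)%N; lia.
  case/negP: dm; move: dn; rewrite {1}nE Gauss_dvdl//.
  by rewrite dE coprimeXl// prime_coprime// dvdn_prime2.
rewrite -lnM ?posrE ?ltr0n ?(prime_gt0 pp)//.
by rewrite nE natrM.
Qed.

(** For positive d, passing from N to N + 1 raises [N %/ d] by one exactly when d divides N + 1. *)
Lemma ln_fact (R : realType) (B N : nat) : (N < B)%N ->
  ln N`!%:R = \sum_(0 <= d < B) mangoldt R d * (N %/ d)%:R.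
Proof.
elim: N => [|N IH] NB.
  rewrite fact0 ln1 big1// => d _; by rewrite div0n mulr0.
rewrite factS natrM lnM ?posrE ?ltr0n ?fact_gt0// IH; last exact: ltnW.
rewrite -(@sum_mangoldt_dvd R B)// [X in X + _]big_mkcond -big_split/=.
apply: eq_bigr => -[|d] _; first by rewrite !divn0 mulr0 addr0.
by rewrite divnS// natrD mulrDr; case: ifP => _; rewrite ?mulr1 ?mulr0.
Qed.

(** * Chebyshev's upper bound *)

Definition chebyshev_psi (R : realType) (N : nat) : R :=
  \sum_(0 <= d < N.+1) mangoldt R d.

(* A prime power [d] with [max a b < d <= a + b] contributes one factor to the
   binomial coefficient. *)
Lemma chebyshev_psi_bin (R : realType) (a b : nat) : (b <= a)%N ->
  chebyshev_psi R (a + b) - chebyshev_psi R a <= ln 'C(a + b, a)%:R.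
Proof.
move=> ba; have := bin_fact (leq_addr b a); rewrite addKn => binE.
have -> : ln 'C(a + b, a)%:R
    = ln (a + b)`!%:R - ln a`!%:R - ln b`!%:R :> R.
  rewrite -binE !natrM !lnM ?posrE ?mulr_gt0 ?ltr0n ?fact_gt0 ?bin_gt0 ?leq_addr//.
  ring.
rewrite !(@ln_fact R (a + b).+1) ?ltnS ?leq_addr ?leq_addl//.
rewrite -!sumrB /chebyshev_psi.
rewrite [X in X - _](@big_cat_nat _ _ _ a.+1)//= ?ltnS ?leq_addr//.
rewrite addrAC subrr add0r.
rewrite [leRHS](@big_cat_nat _ _ _ a.+1)//= ?ltnS ?leq_addr//.
rewrite -[leLHS]add0r; apply: lerD.
  rewrite big_nat_cond sumr_ge0// => -[|d] _; first by rewrite !divn0 mulr0 !subr0.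
  rewrite -!mulrBr mulr_ge0 ?mangoldt_ge0// divnD// !natrD.
  by rewrite -addrA -opprD addrAC subrr add0r ler0n.
rewrite big_nat_cond [leRHS]big_nat_cond; apply: ler_sum => -[//|d].
rewrite andbT ltnS => /andP[ad dab]; rewrite -!mulrBr ler_peMr ?mangoldt_ge0//.
rewrite divnD// !(divn_small, modn_small)//; [|lia..].
by rewrite -ltnS dab/= !subr0.
Qed.

(** The factor 2 saved over the full row sum 2 ^ (m + 1) is what closes the odd case of
    [chebyshev_psi_le]. *)
Lemma bin_le_exp2 (m i : nat) : ('C(m.+1, i) <= 2 ^ m)%N.
Proof.
elim: m i => [|m IH] [|i]; rewrite ?bin0 ?expn_gt0//.
  by rewrite binS bin0n; case: i.
by rewrite binS expnS mul2n -addnn leq_add.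
Qed.

Lemma ln_bin_le (R : realType) (m i : nat) : (i <= m.+1)%N ->
  ln 'C(m.+1, i)%:R <= m%:R * ln 2 :> R.
Proof.
move=> im; rewrite mulr_natl -lnXn// -natrX.
rewrite ler_ln ?posrE ?ltr0n ?bin_gt0 ?expn_gt0//.
by rewrite ler_nat bin_le_exp2.
Qed.

(** Halving induction: N is split as a + b with a = b or a = b + 1, and the increment from a to N is
    bounded by a binomial coefficient. *)
Lemma chebyshev_psi_le (R : realType) (N : nat) :
  chebyshev_psi R N <= N%:R * (2 * ln 2).
Proof.
have l2 : 0 <= ln 2 :> R by rewrite ln_ge0// ler1n.
elim/ltn_ind: N => N IH.
have [N1|N1] := leqP N 1.
  rewrite (@le_trans _ _ 0)// ?mulr_ge0//.
  rewrite /chebyshev_psi big_nat_cond big1// => -[|[|d]]; rewrite ?andbT; try lia.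
  - by rewrite /mangoldt.
  - by rewrite /mangoldt.
pose n := N./2; case oN : (odd N).
  have NE : N = (n.+1 + n)%N by rewrite /n; lia.
  have := chebyshev_psi_bin R _ _ (leqnSn n); rewrite -NE lerBlDl => /le_trans; apply.
  have := IH n.+1; rewrite NE => /(_ ltac:(lia)) h.
  have := ln_bin_le R (n + n) n.+1; rewrite -addSn => /(_ ltac:(lia)) h2.
  apply: le_trans (lerD h h2) _.
  rewrite !natrD -(natr1 n); nra.
have NE : N = (n + n)%N by rewrite /n; lia.
have := chebyshev_psi_bin R _ _ (leqnn n); rewrite -NE lerBlDl => /le_trans; apply.
have n0 : (0 < n)%N by lia.
have := IH n; rewrite {1}NE => /(_ ltac:(lia)) h.
have := ln_bin_le R N.-1 n; rewrite prednK; last by lia.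
move=> /(_ ltac:(lia)) h2.
apply: le_trans (lerD h h2) _.
have h3 : N.-1%:R * ln 2 <= N%:R * ln 2 :> R.
  by rewrite ler_wpM2r// ler_nat leq_pred.
have NE' : N%:R = n%:R + n%:R :> R by rewrite -natrD -NE.
rewrite {}NE' in h3 *; lra.
Qed.

(** * A Mertens-type estimate over odd integers, and summation by parts *)

(** For d > 0, (N + 1) / d is at most [N %/ d] + 1; the first term sums to ln N! and the second to
    [chebyshev_psi]. *)
Lemma sum_mangoldt_div_le (R : realType) (N : nat) :
  N.+1%:R * (\sum_(0 <= d < N.+1) mangoldt R d / d%:R)
    <= ln N`!%:R + chebyshev_psi R N.
Proof.
rewrite (@ln_fact R N.+1)// /chebyshev_psi -big_split/= mulr_sumr.
apply: ler_sum => -[|d] _.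
  by rewrite invr0 !mulr0 add0r mangoldt_ge0.
rewrite -[X in _ + X]mulr1 -mulrDr mulrCA ler_wpM2l ?mangoldt_ge0//.
by rewrite ler_pdivrMr// natr1 -natrM ler_nat ltn_ceil.
Qed.

(** The powers 2, 4, ..., 2 ^ k alone contribute the geometric sum on the left. *)
Lemma sum_mangoldt_even_ge (R : realType) (N k : nat) : (2 ^ k <= N)%N ->
  (1 - (2 ^+ k)^-1) * ln 2
    <= \sum_(0 <= d < N.+1 | ~~ odd d) mangoldt R d / d%:R.
Proof.
have t0 d : 0 <= mangoldt R d / d%:R by rewrite divr_ge0 ?mangoldt_ge0.
elim: k N => [|k IH] N kN.
  by rewrite expr0 invr1 subrr mul0r sumr_ge0.
have kN' : (2 ^ k < 2 ^ k.+1)%N by rewrite ltn_exp2l.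
rewrite (@big_cat_nat _ _ _ (2 ^ k).+1)//=; last exact/ltnW/(leq_trans kN').
rewrite (@big_cat_nat _ _ _ (2 ^ k.+1) (2 ^ k).+1)//=; last exact: leqW.
rewrite [X in _ + (_ + X)]big_ltn_cond//.
rewrite oddX/= mangoldtX//.
have := IH _ (leqnn _).
set S1 := \sum_(0 <= _ < _ | _) _; set S2 := \sum_(_ <= _ < 2 ^ _ | _) _.
set S3 := \sum_(_ <= _ < N.+1 | _) _ => h1.
have h2 : 0 <= S2 by rewrite sumr_ge0.
have h3 : 0 <= S3 by rewrite sumr_ge0.
rewrite natrX exprS.
have x0 : 2 ^+ k != 0 :> R by rewrite expf_neq0.
have -> : (1 - (2 * 2 ^+ k)^-1) * ln 2
    = (1 - (2 ^+ k)^-1) * ln 2 + ln 2 / (2 * 2 ^+ k) :> R.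
  by field.
lra.
Qed.

Definition odd_sum (R : realType) (N : nat) : R :=
  \sum_(0 <= d < N.+1 | odd d) mangoldt R d / d%:R.

(** With k = [trunc_log 2 N], the even part times N + 1 is at least (N + 1) ln 2 - 2 ln 2, which
    cuts Chebyshev's 2 N ln 2 down to (N + 1) ln 2. *)
Lemma odd_sum_le_fact (R : realType) (N : nat) : (0 < N)%N ->
  N.+1%:R * odd_sum R N <= ln N`!%:R + N.+1%:R * ln 2.
Proof.
move=> N0; have := sum_mangoldt_div_le R N.
rewrite (bigID odd)/= -/(odd_sum R N).
set E := \sum_(_ <= _ < _ | ~~ _) _ => h1.
have h2 := chebyshev_psi_le R N.
have h3 : (1 - (2 ^+ trunc_log 2 N)^-1) * ln 2 <= E.
  by apply: sum_mangoldt_even_ge; exact: trunc_logP.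
have l2 : 0 <= ln 2 :> R by rewrite ln_ge0// ler1n.
have h4 : N.+1%:R / 2 ^+ trunc_log 2 N <= 2 :> R.
  rewrite ler_pdivrMr ?exprn_gt0// -exprS -natrX ler_nat.
  exact: trunc_log_ltn.
have h5 : N.+1%:R * ((1 - (2 ^+ trunc_log 2 N)^-1) * ln 2) <= N.+1%:R * E.
  by rewrite ler_wpM2l.
have h6 := ler_wpM2r l2 h4.
rewrite -natr1 in h1 h5 h6 *; lra.
Qed.

Lemma ln_succ_sub_ge (R : realType) (n : nat) : (0 < n)%N ->
  n.+1%:R^-1 <= ln n.+1%:R - ln n%:R :> R.
Proof.
move=> n0; rewrite lerBrDl -lerBrDr.
have -> : ln n%:R = ln n.+1%:R + ln (1 + - n.+1%:R^-1) :> R.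
  have E : 1 + - n.+1%:R^-1 = n%:R / n.+1%:R :> R.
    by rewrite -natr1; field; rewrite natr1 pnatr_eq0.
  rewrite E -lnM ?posrE ?divr_gt0 ?ltr0n//.
  by rewrite mulrC divfK.
rewrite lerD2l le_ln1Dx// ltrN2 invf_lt1 ?ltr0n// ltr1n; lia.
Qed.

Lemma ln2_le (R : realType) : ln 2 <= 4 / 5 :> R.
Proof.
(* Here ln (1 + x) <= x gives 1/5 + 1/4 + 1/3 = 47/60 < 4/5. *)
have -> : 2 = (1 + 5^-1) * ((1 + 4^-1) * (1 + 3^-1)) :> R by field.
rewrite !lnM ?posrE//; try lra.
have h (x : R) : 0 < x -> ln (1 + x) <= x by move=> x0; rewrite le_ln1Dx//; lra.
have h3 := h 3^-1 ltac:(lra); have h4 := h 4^-1 ltac:(lra).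
have h5 := h 5^-1 ltac:(lra); lra.
Qed.

(** The induction step gains 4 (N + 1) (ln (N + 1) - ln N) >= 4 on the right and pays 5 ln 2 <= 4.
    The base case is 5040 ^ 4 * 2 ^ 40 <= 7 ^ 32; the inequality fails at N = 6. *)
Lemma ln_fact_le (R : realType) (N : nat) : (7 <= N)%N ->
  4 * ln N`!%:R + 5 * (N.+1%:R * ln 2) <= 4 * (N.+1%:R * ln N%:R) :> R.
Proof.
elim: N => // N IH; rewrite leq_eqVlt => /predU1P[[<-]|N7].
  have e k (x : R) : 0 < x -> k%:R * ln x = ln (x ^+ k).
    by move=> x0; rewrite lnXn// mulr_natl.
  have -> : 7`! = 5040%N by [].
  rewrite !mulrA -!natrM !e// -lnM ?posrE ?exprn_gt0//.
  by rewrite ler_ln ?posrE ?mulr_gt0 ?exprn_gt0//; lra.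
have N0 : (0 < N)%N by lia.
have := IH N7; have := ln_succ_sub_ge R _ N0; have := ln2_le R.
rewrite factS natrM lnM ?posrE ?ltr0n ?fact_gt0//.
rewrite -(natr1 N.+1).
set a := ln N.+1%:R; set b := ln N%:R; set c := ln _`!%:R; set n := N.+1%:R.
move=> h1 h2 h3.
have n0 : 0 < n by rewrite ltr0n.
have : 1 <= n * (a - b) by rewrite -ler_pdivrMl// mulr1.
lra.
Qed.

(* The constant [ln 2 / 4] is small enough for this elementary estimate and large
   enough for [ln_le_ln2] to absorb the diverted jumps. *)
Lemma odd_sum_le (R : realType) (N : nat) : (3 <= N)%N ->
  odd_sum R N <= ln N%:R - ln 2 / 4.
Proof.
move=> N3; have [N7|N7] := leqP 7 N.
  have := odd_sum_le_fact R N ltac:(lia); have := ln_fact_le R _ N7.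
  move=> h1 h2; rewrite -(ler_pM2l (_ : 0 < N.+1%:R))//; lra.
(* For N from 3 to 6 the crude comparison of [odd_sum R 6] with ln 3 - (ln 2) / 4 suffices, through
   5 ^ 3 <= 2 ^ 7 and 2 ^ 3 <= 3 ^ 2. *)
have e k (x : R) : 0 < x -> k%:R * ln x = ln (x ^+ k).
  by move=> x0; rewrite lnXn// mulr_natl.
have l5 : 3%:R * ln 5 <= 7%:R * ln 2 :> R.
  by rewrite !e// ler_ln ?posrE ?exprn_gt0//; lra.
have l3 : 3%:R * ln 2 <= 2%:R * ln 3 :> R.
  by rewrite !e// ler_ln ?posrE ?exprn_gt0//; lra.
have lN : ln 3 <= ln N%:R :> R by rewrite ler_ln ?posrE ?ltr0n ?ler_nat//; lia.
have l2 : 0 <= ln 2 :> R by rewrite ln_ge0// ler1n.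
have : odd_sum R N <= odd_sum R 6.
  rewrite /odd_sum [leRHS](@big_cat_nat _ _ _ N.+1)//= lerDl.
  by rewrite sumr_ge0// => d _; rewrite divr_ge0 ?mangoldt_ge0.
have -> : odd_sum R 6 = ln 3 / 3 + ln 5 / 5.
  rewrite /odd_sum !big_mkcond/= !big_nat_recr//= big_nil.
  by rewrite /mangoldt/= !mul0r !add0r ?addr0.
lra.
Qed.

Lemma odd_sum2 (R : realType) : odd_sum R 2 = 0.
Proof.
rewrite /odd_sum big_mkcond/= !big_nat_recr//= big_nil.
by rewrite /mangoldt/= !mul0r !add0r.
Qed.

(* Summation by parts: compared with the integral of [2 / (s + u) ^ 3] against
   the bound [u - ln 2 / 4] on [odd_sum] at [expR u]. *)
Lemma sum_mangoldt_odd_sqr_le (R : realType) (s : R) (N : nat) : 0 < s ->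
  \sum_(0 <= d < N | odd d) mangoldt R d / (d%:R * (s + ln d%:R) ^+ 2)
    <= (s + ln 2 / 4)^-1.
Proof.
move=> s0.
have l2 : 0 < ln 2 :> R by rewrite ln_gt0// ltr1n.
pose S N := \sum_(0 <= d < N.+1 | odd d)
  mangoldt R d / (d%:R * (s + ln d%:R) ^+ 2).
have t0 d : 0 <= mangoldt R d / (d%:R * (s + ln d%:R) ^+ 2).
  by rewrite divr_ge0 ?mangoldt_ge0// mulr_ge0// sqr_ge0.
(* The right side is the integral of (s + u) ^ -2 for u from (ln 2) / 4 to ln (n + 2). The slack in
   the bound on [odd_sum] is kept on the left as a nonnegative reserve for later terms. *)
suff key n : S n.+2 + (ln n.+2%:R - ln 2 / 4 - odd_sum R n.+2)
    / (s + ln n.+2%:R) ^+ 2 <= (s + ln 2 / 4)^-1 - (s + ln n.+2%:R)^-1.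
  have b : odd_sum R N.+2 <= ln N.+2%:R - ln 2 / 4.
    by case: (N) => [|n]; [rewrite odd_sum2; lra | exact: odd_sum_le].
  apply: (@le_trans _ _ (S N.+2)).
    rewrite /S [leRHS](@big_cat_nat _ _ _ N)//=; last by lia.
    by rewrite lerDl sumr_ge0.
  apply: le_trans (le_trans _ (key N)) _.
    by rewrite lerDl divr_ge0 ?sqr_ge0// subr_ge0.
  by rewrite gerBl invr_ge0 addr_ge0 ?ltW// ln_gt0// ltr1n.
elim: n => [|n IH].
  rewrite /S odd_sum2 big_mkcond/= !big_nat_recr//= big_nil.
  rewrite /mangoldt/= !mul0r !add0r subr0.
  set l := ln 2 in l2 *.
  rewrite -subr_ge0.
  have -> : (s + l / 4)^-1 - (s + l)^-1 - (l - l / 4) / (s + l) ^+ 2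
     = (l - l / 4) ^+ 2 / ((s + l / 4) * (s + l) ^+ 2).
    by field; apply/andP; split; apply: lt0r_neq0; lra.
  by rewrite divr_ge0 ?sqr_ge0// mulr_ge0 ?sqr_ge0//; lra.
have b : odd_sum R n.+2 <= ln n.+2%:R - ln 2 / 4.
  by case: (n) => [|k]; [rewrite odd_sum2; lra | exact: odd_sum_le].
have -> : S n.+3 = S n.+2
    + (odd_sum R n.+3 - odd_sum R n.+2) / (s + ln n.+3%:R) ^+ 2.
  have recr (f : nat -> R) : \sum_(0 <= d < n.+4 | odd d) f d
      = \sum_(0 <= d < n.+3 | odd d) f d + if odd n.+3 then f n.+3 else 0.
    by rewrite big_mkcond big_nat_recr//= -big_mkcond.
  rewrite /S /odd_sum !recr addrAC subrr add0r.
  by case: ifP => _; rewrite ?mul0r// invfM mulrA.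
have x0 : 0 < ln n.+2%:R :> R by rewrite ln_gt0// ltr1n.
have xy : ln n.+2%:R <= ln n.+3%:R :> R by rewrite ler_ln ?posrE// ler_nat.
move: IH b; set x := ln n.+2%:R in x0 xy *; set y := ln n.+3%:R in xy *.
set T := odd_sum R n.+2; set T' := odd_sum R n.+3; set c := ln 2 / 4.
move=> IH b.
(* The new value T' cancels: it enters [S] and leaves the slack with the same weight. *)
have -> : S n.+2 + (T' - T) / (s + y) ^+ 2 + (y - c - T') / (s + y) ^+ 2
  = S n.+2 + (x - c - T) / (s + y) ^+ 2 + (y - x) / (s + y) ^+ 2.
  by field; apply: lt0r_neq0; lra.
have h1 : (x - c - T) / (s + y) ^+ 2 <= (x - c - T) / (s + x) ^+ 2.
  rewrite ler_wpM2l ?subr_ge0// lef_pV2 ?posrE ?exprn_gt0//; try lra.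
  by rewrite lerXn2r ?nnegrE//; lra.
have h2 : (y - x) / (s + y) ^+ 2 <= (s + x)^-1 - (s + y)^-1.
  rewrite -subr_ge0.
  have -> : (s + x)^-1 - (s + y)^-1 - (y - x) / (s + y) ^+ 2
     = (y - x) ^+ 2 / ((s + x) * (s + y) ^+ 2).
    by field; apply/andP; split; apply: lt0r_neq0; lra.
  by rewrite divr_ge0 ?sqr_ge0// mulr_ge0 ?sqr_ge0//; lra.
lra.
Qed.

(** * The random walk and its superharmonic weight *)

(** Double counting of the pairs (m, k) with m = f k: every nonzero term on the left has a preimage,
    and further preimages only enlarge the right side. *)
Lemma sum_le_image (R : realType) (B : nat) (P Q : pred nat) (G : nat -> R)
    (f : nat -> nat) : (forall m, 0 <= G m) ->
  (forall m, (m < B)%N -> P m -> G m != 0 ->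
    exists k, [/\ (k < B)%N, Q k & m = f k]) ->
  \sum_(0 <= m < B | P m) G m <= \sum_(0 <= k < B | Q k) G (f k).
Proof.
move=> G0 fP.
apply: (@le_trans _ _ (\sum_(0 <= m < B) \sum_(0 <= k < B | Q k)
    if m == f k then G (f k) else 0)).
  rewrite big_mkcond big_nat_cond [leRHS]big_nat_cond.
  apply: ler_sum => m; rewrite andbT => /= mB.
  have r0 (r : seq nat) : 0 <= \sum_(k <- r | Q k) if m == f k then G (f k) else 0.
    by apply: sumr_ge0 => k _; case: ifP.
  case: ifP => // Pm; have [->//|/(fP _ mB Pm)[k [kB Qk mk]]] := eqVneq (G m) 0.
  rewrite (@big_cat_nat _ _ _ k)//=; last exact: ltnW.
  by rewrite [X in _ + X]big_ltn_cond// Qk -mk eqxx addrCA lerDl addr_ge0.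
rewrite exchange_big/=; apply: ler_sum => k _.
by rewrite -big_mkcond big_nat1_eq; case: ifP.
Qed.

Definition erdos_weight (R : realType) (n : nat) : R := 1 / (n%:R * ln n%:R).

Lemma erdos_weight_ge0 (R : realType) (n : nat) : 0 <= erdos_weight R n.
Proof.
rewrite /erdos_weight; case: n => [|n]; first by rewrite mul0r invr0 mulr0.
by rewrite divr_ge0 ?mulr_ge0 ?ln_ge0// ler1n.
Qed.

(* A random walk down the divisibility order, from [m] to [m / d] with
   probability [mangoldt d / ln m]; the jump of a prime power to [1] is diverted
   to its prime, so that the walk stops exactly at the primes. *)
Definition transition (R : realType) (m n : nat) : R :=
  if [&& 1 < n, n < m & n %| m]%N then
    (mangoldt R (m %/ n) + (if n == pdiv m then mangoldt R m else 0)) / ln m%:R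
  else 0.

Lemma transition_ge0 (R : realType) (m n : nat) : 0 <= transition R m n.
Proof.
rewrite /transition; case: ifP => // /and3P[n1 nm _].
rewrite divr_ge0 ?addr_ge0 ?mangoldt_ge0 ?ln_ge0 ?ler1n//; last by lia.
by case: ifP => // _; exact: mangoldt_ge0.
Qed.

(** The quotients d = m / n run over the divisors of m other than 1 and m. The term d = 1 is zero,
    and the diverted jump to [pdiv m] restores the term d = m. *)
Lemma sum_transition_ge1 (R : realType) (B m : nat) :
  (1 < m)%N -> (m < B)%N -> ~~ prime m ->
  1 <= \sum_(0 <= n < B) transition R m n.
Proof.
move=> m1 mB mNp.
have lm : 0 < ln m%:R :> R by rewrite ln_gt0// ltr1n.
rewrite /transition -big_mkcond/= -mulr_suml ler_pdivlMr// mul1r.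
rewrite big_split/= -big_mkcondr/=.
have pm : (1 < pdiv m < m)%N.
  rewrite prime_gt1 ?pdiv_prime//= ltn_neqAle pdiv_leq ?andbT; last by lia.
  by apply: contraNneq mNp => <-; exact: pdiv_prime.
have -> : \sum_(0 <= i < B | [&& 1 < i, i < m & i %| m]%N && (i == pdiv m))
    mangoldt R m = mangoldt R m.
  rewrite (eq_bigl (fun i => i == pdiv m)).
    by rewrite big_nat1_eq; case: ifP => //; lia.
  move=> i/=; case: eqVneq => [->|]; rewrite ?andbF// !andbT pdiv_dvd andbT.
  by case/andP: pm => -> ->.
rewrite -(@sum_mangoldt_dvd R B)//; last by lia.
rewrite (bigID (fun d => d == m))/= addrC; apply: lerD.
  apply: (@sum_le_image R B _ _ (mangoldt R) (fun n => m %/ n)%N).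
    exact: mangoldt_ge0.
  move=> d dB /andP[dm dNm] Ld; exists (m %/ d)%N.
  have d0 : (0 < d)%N by rewrite (dvdn_gt0 _ dm)//; lia.
  have d1 : d != 1%N by apply: contra_neq Ld => ->; rewrite /mangoldt.
  have mE := divnK dm; set e := (m %/ d)%N in mE *.
  have e1 : (1 < e)%N by case: e mE => [|[|e]]//; lia.
  have em : (e < m)%N by rewrite -mE ltn_Pmulr//; lia.
  split; first lia.
    by rewrite e1 em -mE dvdn_mulr.
  by rewrite -mE mulnC mulnK//; lia.
rewrite (eq_bigl (fun i => i == m)).
  by rewrite big_nat1_eq; case: ifP => // _; exact: mangoldt_ge0.
by move=> i; case: eqVneq => [->|]; rewrite ?dvdnn ?andbF.
Qed.

Lemma sum_geometric_le (R : realType) (x : R) (N : nat) : 0 <= x < 1 ->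
  \sum_(0 <= k < N | (1 < k)%N) x ^+ k <= x ^+ 2 / (1 - x).
Proof.
move=> /andP[x0 x1].
(* Two extra terms make the closed form below valid from N = 0 on. *)
apply: (@le_trans _ _ (\sum_(0 <= k < N.+2 | (1 < k)%N) x ^+ k)).
  rewrite [leRHS](@big_cat_nat _ _ _ N)//=; last by lia.
  by rewrite lerDl sumr_ge0// => k _; exact: exprn_ge0.
have -> : \sum_(0 <= k < N.+2 | (1 < k)%N) x ^+ k
    = (x ^+ 2 - x ^+ N.+2) / (1 - x).
  elim: N => [|N IH].
    by rewrite subrr mul0r big_mkcond/= !big_nat_recr//= big_nil !add0r.
  rewrite big_mkcond big_nat_recr//= -big_mkcond/= IH (exprS x N.+2).
  by field; lra.
by rewrite ler_wpM2r ?invr_ge0 ?gerBl ?exprn_ge0//; lra.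
Qed.

(** Rearranged, ln q + (ln 2) / 4 <= (q - 1) ln 2, the form that pays for the diverted jumps. The
    base case is 3 ^ 4 <= 2 ^ 7; each step adds at most ln 2 on the left and exactly ln 2 on the
    right. *)
Lemma ln_le_ln2 (R : realType) (q : nat) : (3 <= q)%N ->
  ln q%:R <= (q%:R - 5 / 4) * ln 2 :> R.
Proof.
elim: q => // q IH; rewrite leq_eqVlt => /predU1P[[<-]|q3].
  have : 4%:R * ln 3 <= 7%:R * ln 2 :> R.
    by rewrite !mulr_natl -!lnXn// ler_ln ?posrE ?exprn_gt0//; lra.
  lra.
have : ln q.+1%:R <= ln q%:R + ln 2 :> R.
  rewrite -lnM ?posrE ?ltr0n//; last by lia.
  rewrite ler_ln ?posrE ?mulr_gt0 ?ltr0n//; last by lia.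
  by rewrite -natrM ler_nat; lia.
by have := IH q3; rewrite -natr1; lra.
Qed.

(** Writing m = n d, with d odd because m is, reduces this to [sum_mangoldt_odd_sqr_le] at s = ln
    n. *)
Lemma sum_transition_mangoldt_le (R : realType) (B n : nat) : (1 < n)%N ->
  \sum_(0 <= m < B | [&& odd m, n < m & n %| m]%N)
    erdos_weight R m * (mangoldt R (m %/ n) / ln m%:R)
  <= (n%:R * (ln n%:R + ln 2 / 4))^-1.
Proof.
move=> n1.
have lnn : 0 < ln n%:R :> R by rewrite ln_gt0// ltr1n.
have n0 : 0 < n%:R :> R by rewrite ltr0n; lia.
have l2 : 0 < ln 2 :> R by rewrite ln_gt0// ltr1n.
apply: le_trans (@sum_le_image R B _ odd _ (fun d => n * d)%N _ _) _.
- move=> m; rewrite mulr_ge0 ?erdos_weight_ge0// divr_ge0 ?mangoldt_ge0//.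
  by case: m => [|m]; [rewrite ln0 | rewrite ln_ge0// ler1n].
- move=> m mB /and3P[om nm dm] _; exists (m %/ n)%N.
  have mE := divnK dm; split; last by rewrite mulnC mE.
    by apply: leq_ltn_trans mB; exact: leq_div.
  by move: om; rewrite -{1}mE oddM => /andP[].
rewrite invfM; apply: le_trans (_ : n%:R^-1 * (\sum_(0 <= d < B | odd d)
    mangoldt R d / (d%:R * (ln n%:R + ln d%:R) ^+ 2)) <= _); last first.
  by apply: ler_wpM2l; [rewrite invr_ge0 ltW | exact: sum_mangoldt_odd_sqr_le].
rewrite mulr_sumr; apply: ler_sum => d od.
have d0 : (0 < d)%N by case: d od.
rewrite mulKn; last by lia.
rewrite /erdos_weight natrM lnM ?posrE ?ltr0n//; last by lia.
have d0' : 0 < d%:R :> R by rewrite ltr0n.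
have lnd : 0 <= ln d%:R :> R by rewrite ln_ge0// ler1n.
rewrite le_eqVlt; apply/orP; left; apply/eqP; field.
by rewrite !lt0r_neq0//; lra.
Qed.

(** Only m = q ^ k with k >= 2 contribute, each by 1 / (k ^ 2 q ^ k ln q). Bounding k ^ 2 below by 4
    leaves a geometric series. *)
Lemma sum_transition_diverted_le (R : realType) (B q : nat) : prime q ->
  \sum_(0 <= m < B | [&& q < m, q %| m & q == pdiv m]%N)
    erdos_weight R m * (mangoldt R m / ln m%:R)
  <= (4 * ln q%:R * (q%:R * (q%:R - 1)))^-1.
Proof.
move=> pq; have q1 := prime_gt1 pq.
have lq : 0 < ln q%:R :> R by rewrite ln_gt0// ltr1n.
have q1' : 1 < q%:R :> R by rewrite ltr1n.
apply: le_trans (@sum_le_image R B _ (fun k => 1 < k)%N _ (fun k => q ^ k)%N _ _) _.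
- move=> m; rewrite mulr_ge0 ?erdos_weight_ge0// divr_ge0 ?mangoldt_ge0//.
  by case: m => [|m]; [rewrite ln0 | rewrite ln_ge0// ler1n].
- move=> m mB /and3P[qm dm /eqP qE] G0.
  have : mangoldt R m != 0 by apply: contra_neq G0 => ->; rewrite mul0r mulr0.
  move=> /mangoldt_neq0[p [pp k0 mE]].
  have pE : p = q by rewrite qE mE -(prednK k0) pdiv_pfactor.
  rewrite {}pE in pp k0 mE; exists (logn q m); split=> //.
    by apply: ltn_trans mB; rewrite {2}mE ltn_expl.
  case: (logn q m) k0 mE => [|[|k]]//; rewrite expn1; lia.
have xP : 0 <= (q%:R^-1 : R) < 1.
  by rewrite invr_ge0 ler0n/= invf_lt1//; lra.
have := @sum_geometric_le R _ B xP.
rewrite -(ler_pM2l (_ : 0 < (4 * ln q%:R)^-1)); last first.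
  by rewrite invr_gt0; lra.
have -> : (4 * ln q%:R)^-1 * (q%:R^-1 ^+ 2 / (1 - q%:R^-1))
    = (4 * ln q%:R * (q%:R * (q%:R - 1)))^-1 :> R.
  by field; rewrite !lt0r_neq0//; lra.
apply: le_trans; rewrite mulr_sumr; apply: ler_sum => k k1.
rewrite mangoldtX//; last by lia.
rewrite /erdos_weight natrX lnXn ?ltr0n//; last by lia.
rewrite -[ln q%:R *+ k]mulr_natl exprVn.
have k2 : 2 <= k%:R :> R by rewrite ler_nat.
have qk : 0 < q%:R ^+ k :> R by rewrite exprn_gt0//; lra.
rewrite -invfM.
have -> : 1 / (q%:R ^+ k * (k%:R * ln q%:R)) * (ln q%:R / (k%:R * ln q%:R))
   = (k%:R ^+ 2 * ln q%:R * q%:R ^+ k)^-1 :> R.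
  by field; rewrite !lt0r_neq0//; lra.
rewrite lef_pV2 ?posrE ?mulr_gt0 ?exprn_gt0//; try lra.
do 2 (apply: ler_wpM2r; first exact: ltW); nra.
Qed.

Lemma sum_erdos_weight_transition_le (R : realType) (B n : nat) :
  odd n -> (1 < n)%N ->
  \sum_(0 <= m < B | odd m) erdos_weight R m * transition R m n
    <= erdos_weight R n.
Proof.
move=> on n1.
have l2 : 0 < ln 2 :> R by rewrite ln_gt0// ltr1n.
have n3 : (3 <= n)%N by case: n on n1 => [|[|[|]]].
have n3' : 3 <= n%:R :> R by rewrite ler_nat.
have lnn : 0 < ln n%:R :> R by rewrite ln_gt0// ltr1n.
have := sum_transition_mangoldt_le R B n n1; set S1 := (X in X <= _) => h1.
pose S2 := \sum_(0 <= m < B | [&& n < m, n %| m & n == pdiv m]%N)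
    erdos_weight R m * (mangoldt R m / ln m%:R).
have lm m : (n < m)%N -> 0 <= ln m%:R :> R by move=> nm; rewrite ln_ge0// ler1n; lia.
have t2 m : (n < m)%N -> 0 <= erdos_weight R m * (mangoldt R m / ln m%:R).
  by move=> nm; rewrite mulr_ge0 ?erdos_weight_ge0// divr_ge0 ?mangoldt_ge0 ?lm.
apply: (@le_trans _ _ (S1 + S2)).
  rewrite /S1 /S2 !big_mkcond/= [X in _ <= X + _]big_mkcond.
  rewrite [X in _ <= _ + X]big_mkcond -big_split/=.
  apply: ler_sum => m _; rewrite /transition n1/=.
  case: (odd m) => /=; last first.
    by case: ifP => [/andP[nm _]|_]; rewrite addr_ge0 ?t2.
  case: (ltnP n m) => nm /=; last by rewrite mulr0 addr0.
  case: ifP => /= _; last by rewrite mulr0 addr0.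
  case: ifP => _; last by rewrite !addr0.
  by rewrite mulrDl mulrDr.
have nn : 0 < n%:R :> R by lra.
(* Diverted jumps land only on primes, so a composite n has ordinary inflow only. *)
have [pn|nNp] := boolP (prime n); last first.
  rewrite /S2 big_pred0 ?addr0; last first.
    move=> m; apply/negP => /and3P[nm _ /eqP nE]; case/negP: nNp.
    by rewrite nE pdiv_prime//; lia.
  apply: le_trans h1 _.
  rewrite /erdos_weight div1r lef_pV2 ?posrE ?mulr_gt0//; last lra.
  by rewrite ler_wpM2l; lra.
have h2 := sum_transition_diverted_le R B n pn; have h3 := ln_le_ln2 R n n3.
apply: le_trans (lerD h1 h2) _.
rewrite /erdos_weight div1r.
set L := ln n%:R in lnn h3 *; set l := ln 2 in l2 h3 *; set q := n%:R in n3' nn h3 *.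
rewrite -subr_ge0.
(* The numerator is nonnegative by [ln_le_ln2]. *)
have -> : (q * L)^-1 - ((q * (L + l / 4))^-1 + (4 * L * (q * (q - 1)))^-1)
   = ((q - 1) * l - (L + l / 4)) / (4 * q * L * (L + l / 4) * (q - 1)).
  by field; rewrite !lt0r_neq0//; lra.
rewrite divr_ge0//; first lra.
by rewrite !mulr_ge0//; lra.
Qed.

(** * The flow of mass from a bounded primitive set to primes *)

(** The value at n depends only on larger arguments, so F is built downward from B, one new value at
    [k] in each step. *)
Lemma flow_exists (R : realType) (A : set nat) (w : nat -> R)
    (P : nat -> nat -> R) (B : nat) :
  exists F : nat -> R, forall n, (n < B)%N ->
    F n = if n \in A then w n else \sum_(n.+1 <= m < B) F m * P m n.
Proof.
suff [F FE] : exists F : nat -> R, forall n, (B - B <= n < B)%N ->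
    F n = if n \in A then w n else \sum_(n.+1 <= m < B) F m * P m n.
  by exists F => n nB; apply: FE; rewrite subnn.
elim: {2}B => [|j [F FE]]; first by exists w => n; lia.
pose k := (B - j.+1)%N.
exists (fun n => if n == k then
    (if k \in A then w k else \sum_(k.+1 <= m < B) F m * P m k) else F n).
move=> n /andP[nj nB]; have kn : (k <= n)%N by [].
have E : \sum_(n.+1 <= m < B) F m * P m n = \sum_(n.+1 <= m < B)
    (if m == k then if k \in A then w k else \sum_(k.+1 <= i < B) F i * P i k
     else F m) * P m n.
  rewrite [LHS]big_nat [RHS]big_nat; apply: eq_bigr => m /andP[nm _].
  by rewrite (_ : m == k = false)//; lia.
rewrite -E; case: eqVneq => [->//|nk].
by apply: FE; rewrite nB andbT; lia.
Qed.

(* Push the weight of [A] down the walk. No walk from one element of [A] meets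
   another, so at every [n] the mass [F n] is at most the weight of [n], and all
   of it ends up on primes dividing elements of [A]. *)
Lemma bounded_erdos_sum_le (R : realType) (A : set nat) (B : nat) :
  primitive A -> (forall a, A a -> odd a /\ (a < B)%N) ->
  \sum_(0 <= n < B | n \in A) erdos_weight R n
    <= \sum_(0 <= p < B | p \in prime_divisors_of A) erdos_weight R p.
Proof.
move=> [A1 Aprim] AB.
pose P := @transition R.
have [F FE] := flow_exists R A (erdos_weight R) P B.
have P0 m n : 0 <= P m n by exact: transition_ge0.
have descend (Q : nat -> Prop) :
    (forall n, (n < B)%N -> (forall m, (n < m)%N -> (m < B)%N -> Q m) -> Q n) ->
    forall n, (n < B)%N -> Q n.
  move=> QE n; have [k] := ubnP (B - n); elim: k n => // k IH n nk nB.
  by apply: QE => // m nm mB; apply: IH => //; lia.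
have F0 : forall n, (n < B)%N -> 0 <= F n.
  apply: descend => n nB IH; rewrite FE//; case: ifP => _.
    exact: erdos_weight_ge0.
  rewrite big_nat sumr_ge0// => m /andP[nm mB]; rewrite mulr_ge0//; exact: IH.
have Pdvd m n : P m n != 0 -> [/\ (1 < n)%N, (n < m)%N & (n %| m)%N].
  by rewrite /P /transition; case: ifP => [/and3P[]//|]; rewrite eqxx.
have Fdvd : forall n, (n < B)%N -> F n != 0 -> exists2 a, A a & (n %| a)%N.
  apply: descend => n nB IH; rewrite FE//; case: ifPn => [/set_mem An _|_ S0].
    by exists n.
  have [m mI] : exists m, (n < m < B)%N && (F m * P m n != 0).
    apply: contrapT => /forallNP h; case/negP: S0; apply/eqP.
    rewrite big_nat big1// => m mI; have /negP := h m.
    by rewrite mI/= negbK => /eqP.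
  case/andP: mI => /andP[nm mB]; rewrite mulf_eq0 negb_or => /andP[Fm /Pdvd[_ _ nm']].
  by have [a Aa ma] := IH _ nm mB Fm; exists a => //; exact: dvdn_trans ma.
(* If m carried mass it would divide some b in A; then a divides b, so a = b by primitivity, against
   a < m. *)
have FA a m : A a -> (a %| m)%N -> (a < m)%N -> (m < B)%N -> F m = 0.
  move=> Aa am ltam mB; apply: contraTeq (ltam) => /(Fdvd _ mB)[b Ab mb].
  have ab := Aprim _ _ Aa Ab (dvdn_trans am mb); rewrite -{}ab in mb.
  by rewrite -leqNgt dvdn_leq// ltnW ?A1.
have Fodd m : (m < B)%N -> ~~ odd m -> F m = 0.
  move=> mB em; apply: contraNeq em => /(Fdvd _ mB)[a Aa ma].
  by have [oa _] := AB _ Aa; exact: dvdn_odd ma oa.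
have inflowE n : (n < B)%N -> \sum_(0 <= m < B) F m * P m n
    = \sum_(n.+1 <= m < B) F m * P m n.
  move=> nB; rewrite (@big_cat_nat _ _ _ n.+1)//= big_nat big1 ?add0r// => m mn.
  have -> : P m n = 0 by apply: contraTeq mn => /Pdvd[_ ? _]; lia.
  by rewrite mulr0.
have Fle : forall n, (n < B)%N -> (1 < n)%N -> F n <= erdos_weight R n.
  apply: descend => n nB IH n1.
  have [on|en] := boolP (odd n); last by rewrite Fodd// erdos_weight_ge0.
  rewrite FE//; case: ifPn => // _.
  apply: le_trans (sum_erdos_weight_transition_le R B n on n1).
  rewrite -inflowE// [leRHS]big_mkcond/= big_nat [leRHS]big_nat.
  apply: ler_sum => m /andP[_ mB].
  case: ifPn => [om|em]; last by rewrite Fodd// mul0r.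
  rewrite -/(P m n); have [->|/Pdvd[_ nm _]] := eqVneq (P m n) 0.
    by rewrite !mulr0.
  by rewrite ler_wpM2r ?P0// IH//; lia.
(* Mass at composite numbers moves on entirely, and none of it enters A, since by [FA] proper
   multiples of elements of A are empty. *)
have conserve : \sum_(0 <= m < B | (1 < m)%N && ~~ prime m) F m
    <= \sum_(0 <= n < B | n \notin A) F n.
  apply: (@le_trans _ _ (\sum_(0 <= m < B) F m * \sum_(0 <= n < B) P m n)).
    rewrite big_mkcond big_nat [leRHS]big_nat; apply: ler_sum => m /= mB.
    case: ifPn => [/andP[m1 mNp]|_]; last by rewrite mulr_ge0 ?F0// sumr_ge0.
    by rewrite ler_peMr ?F0// sum_transition_ge1.
  under eq_bigr do rewrite mulr_sumr.
  rewrite exchange_big/= [leRHS]big_mkcond big_nat [leRHS]big_nat.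
  apply: ler_sum => n /= nB; rewrite inflowE//.
  case: ifPn => [nA|/negPn/set_mem nA]; first by rewrite [leRHS]FE// ifN.
  rewrite big_nat big1// => m /andP[nm mB].
  have [->|/Pdvd[_ _ nm']] := eqVneq (P m n) 0; first by rewrite mulr0.
  by rewrite (FA _ _ nA nm')// mul0r.
have small n : (n < B)%N -> (n <= 1)%N -> n \notin A -> F n = 0.
  move=> nB n1 nA; rewrite FE// ifN// big1// => m _.
  have [->|/Pdvd[]] := eqVneq (P m n) 0; [by rewrite mulr0 | lia].
(* Split the total mass once by membership in A and once by primality, then compare the complements
   by [conserve]; 0 and 1 carry nothing. *)
have absorbed : \sum_(0 <= n < B | n \in A) F n
    <= \sum_(0 <= n < B | prime n) F n.
  have := bigID (fun n => n \in A) xpredT F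
    (r := index_iota 0 B) (op := +%R) (idx := 0).
  rewrite (bigID prime)/= => E.
  have E2 : \sum_(0 <= n < B | ~~ prime n) F n
      = \sum_(0 <= m < B | (1 < m)%N && ~~ prime m) F m.
    rewrite big_mkcond [RHS]big_mkcond/= big_nat [RHS]big_nat.
    apply: eq_bigr => n /= nB; case: (ltnP 1 n) => //= n1; case: ifP => // _.
    apply: small => //; apply/negP => /set_mem/A1; lia.
  rewrite E2 in E; lra.
rewrite [leLHS](_ : _ = \sum_(0 <= n < B | n \in A) F n); last first.
  rewrite big_nat_cond [RHS]big_nat_cond; apply: eq_bigr => n /andP[/= nB nA].
  by rewrite FE// nA.
apply: le_trans absorbed _.
rewrite big_mkcond [leRHS]big_mkcond/= big_nat [leRHS]big_nat.
apply: ler_sum => p /= pB; case: ifPn => [pp|_]; last first.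
  by case: ifP => // _; exact: erdos_weight_ge0.
case: ifPn => [_|pA]; first by rewrite Fle// prime_gt1.
have [->//|/(Fdvd _ pB)[a Aa pa]] := eqVneq (F p) 0.
by case/negP: pA; apply: mem_set; split=> //; exists a.
Qed.

(** * From finite sets to arbitrary ones *)

Lemma fsbig_nat (R : realType) (X : set nat) (f : nat -> R) (B : nat) :
  (forall n, X n -> (n < B)%N) ->
  (\sum_(n \in X) (f n)%:E)%E = (\sum_(0 <= n < B | n \in X) f n)%:E.
Proof.
move=> XB; have finX : finite_set X.
  by apply: (@sub_finite_set _ _ `I_B) => //; exact: finite_II.
rewrite fsbig_finite// -sumEFin -[RHS]big_filter; apply: perm_big.
apply: uniq_perm => //; first by rewrite filter_uniq ?iota_uniq.
move=> n; rewrite in_fset_set// mem_filter mem_index_iota/=.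
by case: (boolP (n \in X)) => // /set_mem/XB ->.
Qed.

Theorem theorem1p4 (R : realType) (A : set nat) :
  primitive A ->
  (forall p : nat, prime_divisors_of A p ->
     (3 <= p)%N /\ (p%:R : R) <= expR (10 ^+ 6)) ->
  (erdos_sum R A <= erdos_sum R (prime_divisors_of A))%E.
Proof.
(* The left side is a supremum over finite subsets X of A. Each X is again primitive, and its prime
   divisors form a finite set of prime divisors of A. *)
move=> [A1 Aprim] Aodd; apply: ub_ereal_sup => _ [X [finX XA] <-].
have [B XB] : exists B, forall n, X n -> (n < B)%N.
  have /finite_seqP[s ->] := finX; exists (\max_(n <- s) n).+1 => n ns.
  by rewrite ltnS; exact: leq_bigmax_seq.
pose Y := prime_divisors_of X.
have Xprim : primitive X by split=> [a /XA/A1|a b /XA Aa /XA Ab]//; exact: Aprim.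
have Xodd a : X a -> odd a /\ (a < B)%N.
  move=> Xa; split; last exact: XB.
  (* An even element would make 2 a prime divisor of A, below the lower bound 3. *)
  apply: contraT => ea; have [] := Aodd 2%N; last by [].
  by split=> //; exists a; [exact: XA | rewrite dvdn2].
have YB p : Y p -> (p < B)%N.
  move=> [_ [a Xa pa]]; apply: leq_ltn_trans (XB _ Xa).
  by rewrite dvdn_leq// ltnW// A1//; exact: XA.
apply: esum_ge; exists Y.
  split; first by apply: (@sub_finite_set _ _ `I_B) => //; exact: finite_II.
  by move=> p [pp [a Xa pa]]; split=> //; exists a => //; exact: XA.
rewrite !(@fsbig_nat R _ (erdos_weight R) B)// lee_fin.
exact: bounded_erdos_sum_le.
Qed.
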